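(* Let $(\Omega,\mathcal F,\mathbb P)$ be a probability space, $G=[a,b]\subset\mathbb R$ a compact interval, and $u:G\times\Omega\to\mathbb R$ a random field satisfying (A1) and (A2) such that for $\mathbb P$-almost all $\omega$ the function $u(\cdot,\omega)$ is twice continuously differentiable. For $x\in G$, $\delta>0$ with $x+\delta\in G$ and $\sigma\in\{\pm1\}$ let $$p_\sigma(x,\delta)=\mathbb P\{\sigma u(x)\ge0,\ \sigma u(x+\delta/2)\le 0,\ \sigma u(x+\delta)\ge 0\},$$ and assume there is a constant $\mathcal C_0>0$ with $p_\sigma(x,\delta)\le \mathcal C_0\delta^3$ for all $\sigma\in\{\pm1\}$ and all $x\in G$, $\delta>0$ with $x+\delta\in G$. Then for every $M\in\mathbb N$, $$\mathbb P\{H_*(N^\pm)\cong H_*(Q_M^\pm)\}\ge 1-\frac{8\mathcal C_0(b-a)^3}{3M^2}.$$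
   Context: Random field: a map $u:G\times\Omega\to\mathbb R$ with $u(x,\cdot)$ a random variable for every $x$. (A1): for every $x\in G$, $\mathbb P\{u(x)=0\}=0$. (A2): $\mathbb P\{0 \text{ is a critical value of } u(\cdot,\omega)\}=0$. Nodal domains: $N^\pm=\{x\in G:\pm u(x)\ge0\}$. Cubical approximation (here $d=1$): with $x_k=a+k(b-a)/M$, $k=0,\dots,M$, $Q_M^\pm=\bigcup\{[k,k+1]: k\in\{0,\dots,M\},\ \pm u(x_k)\ge0\}\subset\mathbb R$. $H_*(N^\pm)\cong H_*(Q_M^\pm)$ means the homology groups of $N^+$ and $Q_M^+$ are isomorphic in every degree and likewise for $N^-$ and $Q_M^-$; the probability is that of the set of $\omega$ for which this holds for $u(\cdot,\omega)$. *)

(* Defs.v *)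
From mathcomp Require Import all_boot all_order all_algebra all_classical all_reals all_analysis.
Unset Printing Implicit Defensive.
Import Order.TTheory GRing.Theory Num.Theory.
Import numFieldNormedType.Exports.
Local Open Scope classical_set_scope.
Local Open Scope ring_scope.

Section SingularHomology.
Variable R : realType.

Definition std_simplex (n : nat) : set 'rV[R]_n.+1 :=
  [set t | (forall i, 0 <= t ord0 i) /\ \sum_(i < n.+1) t ord0 i = 1].

(* a singular n-simplex is represented by a map 'rV_(n+1) -> R, normalized
   to be 0 outside the standard simplex (so that maps agreeing on the simplex
   are identified) *)
Definition sing_simplex := fun n : nat => 'rV[R]_n.+1 -> R.

Definition is_sing_simplex (X : set R) (n : nat) (s : sing_simplex n) : Prop :=
  [/\ {within std_simplex n, continuous s},
      s @` std_simplex n `<=` X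
    & forall t, ~ std_simplex n t -> s t = 0].

Definition face_incl (n : nat) (i : 'I_n.+2) (t : 'rV[R]_n.+1) : 'rV[R]_n.+2 :=
  \row_(j < n.+2) match unlift i j with Some j' => t ord0 j' | None => 0 end.

Definition sing_face (n : nat) (i : 'I_n.+2) (s : sing_simplex n.+1) : sing_simplex n :=
  fun t => if `[< std_simplex n t >] then s (face_incl n i t) else 0.

Definition chain_t (n : nat) := sing_simplex n -> int.

Definition is_chain (X : set R) (n : nat) (c : chain_t n) : Prop :=
  finite_set [set s | c s != 0] /\ [set s | c s != 0] `<=` is_sing_simplex X n.

Definition boundary (n : nat) (c : chain_t n.+1) : chain_t n :=
  fun tau => \sum_(s \in [set: sing_simplex n.+1])
     (c s * \sum_(i < n.+2) ((-1) ^+ i * (sing_face n i s == tau)%:R))%R.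

Definition is_cycle (X : set R) (n : nat) (c : chain_t n) : Prop :=
  is_chain X n c /\
  match n return chain_t n -> Prop with
  | 0 => fun _ => True
  | n'.+1 => fun c => boundary n' c = (fun _ => 0)
  end c.

Definition is_boundary (X : set R) (n : nat) (c : chain_t n) : Prop :=
  exists d : chain_t n.+1, is_chain X n.+1 d /\ boundary n d = c.

(* H_n(X) is isomorphic to H_n(Y) (as abelian groups).  An isomorphism
   Z_n(X)/B_n(X) -> Z_n(Y)/B_n(Y) is given through an additive lift
   phi : Z_n(X) -> Z_n(Y) (such a lift always exists since Z_n(X) is a
   free abelian group): phi induces a well-defined injective and surjective
   homomorphism on the quotients. *)
Definition homology_iso (n : nat) (X Y : set R) : Prop :=
  exists phi : chain_t n -> chain_t n,
  [/\ forall z, is_cycle X n z -> is_cycle Y n (phi z),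
      forall z1 z2, is_cycle X n z1 -> is_cycle X n z2 ->
        phi (z1 + z2)%R = (phi z1 + phi z2)%R,
      forall z, is_cycle X n z -> (is_boundary Y n (phi z) <-> is_boundary X n z)
    & forall w, is_cycle Y n w ->
        exists2 z, is_cycle X n z & is_boundary Y n (phi z - w)%R].

Definition homology_iso_all (X Y : set R) : Prop :=
  forall n, homology_iso n X Y.

End SingularHomology.

Section Field.
Variable R : realType.

Definition C2_on (a b : R) (f : R -> R) : Prop :=
  exists g : R -> R,
  [/\ forall x, a <= x <= b -> g x = f x,
      forall x, derivable g x 1,
      forall x, derivable (derive1 g) x 1
    & continuous (derive1n 2 g)].

(* 0 is a critical value of f on [a,b]: there is x in [a,b] with f x = 0
   and f'(x) = 0 (derivative taken within [a,b], i.e. one-sided at the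
   endpoints) *)
Definition zero_critical_value (a b : R) (f : R -> R) : Prop :=
  exists x, [/\ a <= x <= b, f x = 0 &
    (fun y => (f y - f x) / (y - x)) @
      within [set y | a <= y <= b /\ y != x] (nbhs x) --> (0 : R)].

Definition nodal_domain (a b s : R) (f : R -> R) : set R :=
  [set x | a <= x <= b /\ 0 <= s * f x].

Definition grid_point (a b : R) (M k : nat) : R := a + k%:R * (b - a) / M%:R.

Definition cubical_approx (a b s : R) (M : nat) (f : R -> R) : set R :=
  [set y | exists k : nat,
     [/\ (k <= M)%N, 0 <= s * f (grid_point a b M k) & k%:R <= y <= k%:R + 1]].

End Field.

Arguments homology_iso {R}.
Arguments homology_iso_all {R}.
Arguments C2_on {R}.
Arguments zero_critical_value {R}.
Arguments nodal_domain {R}.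
Arguments grid_point {R}.
Arguments cubical_approx {R}.

(* Main.v *)
Require Import Defs.
From mathcomp Require Import all_boot all_order all_algebra all_classical all_reals all_analysis.
From mathcomp Require Import measurable_realfun ring lra.
Import Order.TTheory GRing.Theory Num.Theory.
Import numFieldNormedType.Exports.
Local Open Scope classical_set_scope.
Local Open Scope ring_scope.
Set Implicit Arguments.
Unset Strict Implicit.

(** Outside a null set, [u] vanishes at no dyadic point of the grid cells and
    has no zero that is also a critical point.  If moreover no dyadic cell at
    any level has the sign pattern (s, -s, s) at its two endpoints and its
    midpoint, then repeated bisection shows that [u] changes sign at most once
    in each grid cell and keeps a strict sign elsewhere.  The nodal domain is
    then a union of intervals [[p k, p (k+1)]] with [p k <= x_k <= p (k+1)],
    indexed by the same [k] as the cubical approximation, and the piecewise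
    linear homeomorphism of the line sending [p k] to [k] carries one set to
    the other.  A union bound over the [M 2^n] cells of width [h / 2^n], with
    [h = (b - a) / M], bounds the exceptional probability by
    [sum_n 2 M 2^n C0 (h / 2^n)^3 = (8/3) C0 M h^3]. *)

(** * Invariance of singular homology under homeomorphisms of the line *)

Section Pushforward.
Variable R : realType.
Implicit Types (X Y : set R) (h g : R -> R).

(* Leaving values outside the simplex untouched makes push h a bijection of
   all maps, junk included, whenever h is one. *)
Definition push h {n} (s : sing_simplex R n) : sing_simplex R n :=
  fun t => if `[< std_simplex R n t >] then h (s t) else s t.

Lemma pushK h g n : cancel h g -> cancel (@push h n) (push g).
Proof.
move=> hK s; apply/funext => t; rewrite /push.
by case: asboolP => // _; rewrite hK.
Qed.

Lemma std_simplex_face n (i : 'I_n.+2) t :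
  std_simplex R n t -> std_simplex R n.+1 (face_incl R n i t).
Proof.
move=> [t0 t1]; split=> [j|].
  by rewrite mxE; case: unliftP => [j' _|].
rewrite (bigD1_ord i) //= mxE unlift_none add0r -t1.
by apply: eq_bigr => j _; rewrite mxE liftK.
Qed.

Lemma sing_face_push h n (i : 'I_n.+2) (s : sing_simplex R n.+1) :
  sing_face R n i (push h s) = push h (sing_face R n i s).
Proof.
apply/funext => t; rewrite /sing_face /push.
by case: asboolP => // /(std_simplex_face i) it; rewrite asboolT.
Qed.

Lemma is_sing_simplex_push h X Y n s : continuous h -> h @` X `<=` Y ->
  is_sing_simplex R X n s -> is_sing_simplex R Y n (push h s).
Proof.
move=> hc hXY [sc sX s0]; split.
- have hsc : {within std_simplex R n, continuous (h \o s)}.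
    by apply: within_continuous_comp sc => x _; exact: hc.
  apply: subspace_eq_continuous hsc => t /set_mem ts.
  by rewrite /from_subspace /push /= asboolT.
- move=> _ [t ts <-]; rewrite /push asboolT//; apply: hXY; exists (s t) => //.
  by apply: sX; exists t.
(* As [push] does not apply [h] off the simplex, the normalization to 0 survives even when [h 0] is
   nonzero. *)
- by move=> t nt; rewrite /push asboolF// s0.
Qed.

(** Chains are coefficient functions, so pushing forward along a bijection is precomposition with
    [push] of its inverse [g]; no sum over fibres appears. *)
Definition push_chain g {n} (c : chain_t R n) : chain_t R n :=
  fun s => c (push g s).

(** Faces commute with [push], and [push h] permutes the index set of the sum, which consists of all
    maps; reindexing along it gives the identity. *)
Lemma boundary_push h g n (c : chain_t R n.+1) : cancel h g -> cancel g h ->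
  boundary R n (push_chain g c) = push_chain g (boundary R n c).
Proof.
move=> hK gK; apply/funext => tau; rewrite /boundary /push_chain.
have hB m : bijective (@push h m) by exists (push g); apply: pushK.
rewrite (reindex_fsbigT (push h) _ (hB _)).
apply: eq_fsbigr => s _; rewrite pushK//; congr (_ * _).
apply: eq_bigr => i _; congr (_ * _%:R); rewrite sing_face_push.
by rewrite (can2_eq (pushK (n := n) hK) (pushK (n := n) gK)).
Qed.

Lemma is_chain_push h g X Y n c : cancel h g -> cancel g h ->
  continuous h -> h @` X `<=` Y ->
  is_chain R X n c -> is_chain R Y n (push_chain g c).
Proof.
move=> hK gK hc hXY [cf cX]; split.
  apply: (finite_preimage (f := push g) _ cf).
  by apply: in2W; exact: can_inj (pushK (n := n) gK).
move=> s /= cs; rewrite -(pushK (n := n) gK s).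
by apply: is_sing_simplex_push hc hXY _; exact: cX.
Qed.

Lemma is_cycle_push h g X Y n c : cancel h g -> cancel g h ->
  continuous h -> h @` X `<=` Y ->
  is_cycle R X n c -> is_cycle R Y n (push_chain g c).
Proof.
move=> hK gK hc hXY [cX c0]; split; first exact: is_chain_push hXY cX.
by case: n c cX c0 => [//|n] c cX c0; rewrite (boundary_push _ hK gK)// c0.
Qed.

Lemma is_boundary_push h g X Y n c : cancel h g -> cancel g h ->
  continuous h -> h @` X `<=` Y ->
  is_boundary R X n c -> is_boundary R Y n (push_chain g c).
Proof.
move=> hK gK hc hXY [e [eX <-]]; exists (push_chain g e).
by split; [exact: is_chain_push hXY eX | rewrite (boundary_push _ hK gK)].
Qed.

Lemma push_chainK h g n : cancel h g -> cancel (@push_chain g n) (push_chain h).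
Proof. by move=> hK c; apply/funext => s; rewrite /push_chain (pushK (n := n) hK). Qed.

(** The chain map induced by [h] serves as the lift. The one induced by [g] inverts it on chains, so
    boundaries are reflected and each cycle of [Y] is hit exactly, the difference being the boundary
    of the zero chain. *)
Lemma homology_iso_all_homeo h g X Y : cancel h g -> cancel g h ->
  continuous h -> continuous g -> h @` X `<=` Y -> g @` Y `<=` X ->
  homology_iso_all X Y.
Proof.
move=> hK gK hc gc hXY gYX n; exists (push_chain g); split=> //.
- by move=> z; exact: is_cycle_push.
- move=> z _; split; last exact: is_boundary_push.
  by move=> /(is_boundary_push gK hK gc gYX); rewrite push_chainK.
- move=> w wY; exists (push_chain h w); first exact: is_cycle_push wY.
  rewrite push_chainK// subrr; exists 0; split; last first.
    apply/funext => t; rewrite /boundary fsbig1// => s _.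
    by rewrite mul0r.
  have e0 : [set s : sing_simplex R n.+1 | (0 : chain_t R n.+1) s != 0] = set0.
    by rewrite -subset0 => s /negP; apply; exact/eqP.
  by split; rewrite e0.
Qed.

End Pushforward.

(** * Piecewise linear homeomorphisms of the line *)

Section PiecewiseLinear.
Variable R : realType.

(** The piecewise linear map with slope 1 before [v] and slope [c] after it; the min/max form gives
    continuity without gluing. *)
Definition bend (v c : R) (t : R) : R := Num.min t v + c * Num.max (t - v) 0.

Lemma bend_left (v c t : R) : t <= v -> bend v c t = t.
Proof. by move=> tv; rewrite /bend min_l// max_r ?subr_le0// mulr0 addr0. Qed.

Lemma bend_right (v c t : R) : v <= t -> bend v c t = v + c * (t - v).
Proof. by move=> vt; rewrite /bend min_r// max_l ?subr_ge0. Qed.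

Lemma bendK (v c : R) : 0 < c -> cancel (bend v c) (bend v c^-1).
Proof.
move=> c0 t; case: (leP t v) => [tv|/ltW vt]; first by rewrite !bend_left.
rewrite (bend_right _ vt) bend_right ?lerDl ?mulr_ge0 ?subr_ge0 ?(ltW c0)//.
by field; rewrite gt_eqF.
Qed.

Lemma bend_continuous (v c : R) : continuous (bend v c).
Proof.
move=> t; apply: cvgD.
  by apply: (@continuous_min _ _ (fun x : R => x) (fun=> v)); [exact: cvg_id|exact: cvg_cst].
apply: cvgMr; apply: (@continuous_max _ _ (fun x : R => x - v) (fun=> 0)); last exact: cvg_cst.
by apply: cvgB; [exact: cvg_id|exact: cvg_cst].
Qed.

Lemma bend_mono (v c : R) : 0 < c -> {mono bend v c : x y / x <= y}.
Proof.
move=> c0; apply: le_mono => x y xy.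
case: (leP y v) => [yv|vy]; first by rewrite !bend_left// (le_trans (ltW xy)).
rewrite [ltRHS]bend_right ?ltW//; case: (leP x v) => [xv|/ltW vx].
  by rewrite bend_left// (le_lt_trans xv)// ltrDl mulr_gt0// subr_gt0.
by rewrite bend_right// ltrD2l ltr_pM2l// ltrD2r.
Qed.

(** Induction on the number of knots: once the first ones sit at integers, a [bend] at the last of
    them rescales the half-line beyond it so that the next knot falls on the next integer, and
    leaves the earlier ones fixed. *)
Lemma knot_homeo (p : nat -> R) n : (forall k, (k < n)%N -> p k < p k.+1) ->
  exists h g : R -> R, [/\ cancel h g, cancel g h, continuous h, continuous g &
    {mono h : x y / x <= y} /\ forall k, (k <= n)%N -> h (p k) = k%:R].
Proof.
elim: n => [_|n IH ip].
  exists (fun x => x - p 0%N), (fun x => x + p 0%N); split.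
  - by move=> x; rewrite subrK.
  - by move=> x; rewrite addrK.
  - by move=> x; apply: cvgB; [exact: cvg_id|exact: cvg_cst].
  - by move=> x; apply: cvgD; [exact: cvg_id|exact: cvg_cst].
  - split=> [x y|k]; first by rewrite lerD2r.
    by rewrite leqn0 => /eqP ->; rewrite subrr.
have [k kn|h [g [hK gK hc gc [hm hp]]]] := IH.
  by apply: ip; rewrite ltnS ltnW.
have nh : n%:R < h (p n.+1) by rewrite -(hp n)// (leW_mono hm) ip.
pose c := (h (p n.+1) - n%:R)^-1.
have c0 : 0 < c by rewrite invr_gt0 subr_gt0.
have cV0 : 0 < c^-1 by rewrite invr_gt0.
exists (bend n%:R c \o h), (g \o bend n%:R c^-1); split.
- exact: can_comp (bendK _ c0) hK.
- by apply: can_comp gK _; rewrite -{2}[c]invrK; exact: bendK.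
- by move=> x; apply: continuous_comp; [exact: hc | exact: bend_continuous].
- by move=> x; apply: continuous_comp; [exact: bend_continuous | exact: gc].
- split=> [x y|k]; first by rewrite /= (bend_mono _ c0) hm.
  rewrite leq_eqVlt ltnS => /orP[/eqP ->|kn] /=; last first.
    by rewrite hp// bend_left// ler_nat.
  rewrite bend_right ?(ltW nh)// mulVf ?subr_eq0 ?gt_eqF//.
  by rewrite -[n.+1]addn1 natrD.
Qed.

(** The common shape of nodal domains and cubical approximations: the index set [A] will be the same
    for both, and only the knots differ. *)
Definition bands (p : nat -> R) (n : nat) (A : set nat) : set R :=
  [set y | exists k, [/\ (k < n)%N, A k & p k <= y <= p k.+1]].

Lemma eq_bands (p : nat -> R) n (A B : set nat) :
  (forall k, (k < n)%N -> A k <-> B k) -> bands p n A = bands p n B.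
Proof.
by move=> AB; apply/seteqP; split=> y [k [kn Ak ky]]; exists k; split=> //; apply/AB.
Qed.

Lemma bands_homeo (p : nat -> R) n : (forall k, (k < n)%N -> p k < p k.+1) ->
  exists h g : R -> R, [/\ cancel h g, cancel g h, continuous h, continuous g &
    forall A, h @` bands p n A `<=` bands (fun k => k%:R) n A /\
              g @` bands (fun k => k%:R) n A `<=` bands p n A].
Proof.
move=> /knot_homeo[h [g [hK gK hc gc [hm hp]]]].
exists h, g; split=> // A; split=> _ [y [k [kn Ak ky]] <-]; exists k; split=> //.
  by rewrite -(hp k.+1)// -(hp k) 1?ltnW// !hm.
by rewrite -(hm (p k)) -(hm (g y)) gK !hp// ltnW.
Qed.

End PiecewiseLinear.

(** * Sign changes of a function in dyadic cells *)

Section DyadicCells.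
Variables (R : realType) (a w : R) (M : nat).
Hypothesis w0 : 0 < w.

(** For [w = (b - a) / M], level 0 is the sampling grid. The midpoint of cell [j] of level [n] is
    the point of index [j.*2.+1] of level [n.+1]. *)
Definition dyadic (n j : nat) : R := a + j%:R * (w / 2 ^+ n).

Lemma dyadicS (n j : nat) : dyadic n j.+1 = dyadic n j + w / 2 ^+ n.
Proof. by rewrite /dyadic -addn1 natrD; ring. Qed.

Lemma dyadic_double (n j : nat) : dyadic n.+1 j.*2 = dyadic n j.
Proof.
rewrite /dyadic -muln2 natrM exprS; field.
by rewrite expf_neq0// pnatr_eq0.
Qed.

Lemma dyadic_width_gt0 (n : nat) : 0 < w / 2 ^+ n.
Proof. by rewrite divr_gt0// exprn_gt0. Qed.

Lemma dyadic_width_small (e : R) : 0 < e -> exists n, w / 2 ^+ n < e.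
Proof.
move=> e0; exists (Num.bound (w / e)).
have := archi_boundP (ltW (divr_gt0 w0 e0)).
set n := Num.bound _ => wn; rewrite ltr_pdivrMr ?exprn_gt0// mulrC -ltr_pdivrMr//.
by rewrite (lt_trans wn)// -natrX ltr_nat ltn_expl.
Qed.

Lemma le_dyadic (n i j : nat) : (dyadic n i <= dyadic n j) = (i <= j)%N.
Proof. by rewrite lerD2l ler_pM2r ?dyadic_width_gt0// ler_nat. Qed.

Lemma doubleS_ltn (m N i : nat) : (i < N * 2 ^ m)%N -> (i.*2.+1 < N * 2 ^ m.+1)%N.
Proof. by rewrite expnS mulnCA mul2n -doubleS leq_double. Qed.

(** A positive product encodes equal strict signs. Multiplying both products and cancelling the
    square of [x] makes this relation transitive. *)
Lemma mul_gt0_trans (x y z : R) : 0 < x * y -> 0 < x * z -> 0 < y * z.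
Proof.
move=> xy xz; have x0 : x != 0 by apply: contraTneq xy => ->; rewrite mul0r ltxx.
have := mulr_gt0 xy xz; rewrite mulrACA pmulr_rgt0//.
by rewrite -expr2 exprn_even_gt0.
Qed.

Variable f : R -> R.
Hypothesis f_cont : continuous f.
Hypothesis f_dyadic : forall n j, (j <= M * 2 ^ n)%N -> f (dyadic n j) != 0.
Hypothesis f_no_double_crossing : forall n j, (j < M * 2 ^ n)%N ->
  0 < f (dyadic n j) * f (dyadic n j.+1) ->
  0 < f (dyadic n j) * f (dyadic n.+1 j.*2.+1).
(** A zero inside an interval of weakly constant sign is a local extremum, hence a critical point;
    in this form (A2) enters the bisection. *)
Hypothesis f_crit : forall s p q c, a <= p -> q <= dyadic 0 M -> p < c < q ->
  s != 0 -> (forall x, p <= x <= q -> 0 <= s * f x) -> f c != 0.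

Lemma dyadic_last (n j : nat) : (j <= M * 2 ^ n)%N -> dyadic n j <= dyadic 0 M.
Proof.
move=> jM; have -> : dyadic 0 M = dyadic n (M * 2 ^ n).
  rewrite /dyadic natrM natrX expr0; field.
  by rewrite expf_neq0// pnatr_eq0.
by rewrite le_dyadic.
Qed.

Lemma dyadic_ge (n j : nat) : a <= dyadic n j.
Proof. by rewrite lerDl mulr_ge0// ltW// dyadic_width_gt0. Qed.

Lemma dyadic_bisect (n i : nat) (x : R) : dyadic n i <= x <= dyadic n i.+1 ->
  dyadic n i <= x <= dyadic n.+1 i.*2.+1 \/
  dyadic n.+1 i.*2.+1 <= x <= dyadic n i.+1.
Proof.
by move=> /andP[ix xi]; case: (leP x (dyadic n.+1 i.*2.+1)) => [xm|/ltW mx];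
  [left | right]; apply/andP.
Qed.

(** Bisection towards [x]: without a double crossing the midpoint shares the sign of both ends, so
    either half inherits the invariant and the one containing [x] is kept. *)
Lemma same_sign_cells (n j : nat) (x : R) : (j < M * 2 ^ n)%N ->
  0 < f (dyadic n j) * f (dyadic n j.+1) -> dyadic n j <= x <= dyadic n j.+1 ->
  forall m, exists i, [/\ (i < M * 2 ^ (n + m))%N,
    dyadic (n + m) i <= x <= dyadic (n + m) i.+1,
    0 < f (dyadic n j) * f (dyadic (n + m) i) &
    0 < f (dyadic n j) * f (dyadic (n + m) i.+1)].
Proof.
move=> jM jj jx; elim=> [|m [i [iM ix fi fi1]]].
  exists j; rewrite addn0; split=> //.
  by rewrite -expr2 exprn_even_gt0//= f_dyadic// ltnW.
have mid := f_no_double_crossing iM (mul_gt0_trans fi fi1).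
have fm : 0 < f (dyadic n j) * f (dyadic (n + m).+1 i.*2.+1).
  by apply: mul_gt0_trans mid; rewrite mulrC.
have iM2 := doubleS_ltn iM.
rewrite addnS; have [ix'|ix'] := dyadic_bisect ix.
  by exists i.*2; rewrite dyadic_double; split=> //; exact: ltnW.
by exists i.*2.+1; rewrite -doubleS dyadic_double; split.
Qed.

Lemma same_sign_cell (n j : nat) (x : R) : (j < M * 2 ^ n)%N ->
  0 < f (dyadic n j) * f (dyadic n j.+1) -> dyadic n j <= x <= dyadic n j.+1 ->
  0 < f (dyadic n j) * f x.
Proof.
move=> jM jj; have fj0 : f (dyadic n j) != 0 by rewrite f_dyadic// ltnW.
(* Weak sign first: a wrong strict sign at [y] would persist on a ball, yet endpoints of arbitrarily
   small cells around [y] carry the right sign. *)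
have ge0 y : dyadic n j <= y <= dyadic n j.+1 -> 0 <= f (dyadic n j) * f y.
  move=> jy; rewrite leNgt; apply/negP => fy.
  have : \forall z \near y, f (dyadic n j) * f z < 0.
    have gc : {for y, continuous (fun z => f (dyadic n j) * f z)}.
      by apply: cvgMr; exact: f_cont.
    exact: (gc _ (lt_nbhsl fy)).
  move=> /nbhs_ballP[e /= e0 fe].
  have [m me] := dyadic_width_small e0.
  have [i [_ /andP[iy yi] fi _]] := same_sign_cells jM jj jy m.
  suff /fe : ball y e (dyadic (n + m) i) by rewrite /= ltNge (ltW fi).
  rewrite /ball /= ger0_norm ?subr_ge0// ltrBlDl (le_lt_trans yi)// dyadicS ltrD2l.
  apply: le_lt_trans me; rewrite ler_pM2l// lef_pV2 ?posrE ?exprn_gt0//.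
  by rewrite ler_eXn2l ?ltr1n// leq_addl.
(* Strictness: the ends are dyadic points, where [f] is nonzero, and an interior zero is excluded by
   [f_crit]. *)
move=> jx; rewrite lt_neqAle ge0// andbT eq_sym mulf_neq0//.
have [->//|xj] := eqVneq x (dyadic n j).
have [->|xj1] := eqVneq x (dyadic n j.+1); first exact: f_dyadic.
apply: (f_crit (dyadic_ge n j) (dyadic_last jM) _ fj0 ge0).
by case/andP: jx => jx xj1'; rewrite !lt_neqAle jx xj1' eq_sym xj xj1.
Qed.

(** Bisection towards the sign change: the half that is discarded has equal signs at its ends, so
    [same_sign_cell] fixes the sign on all of it. *)
Lemma sign_change_cells (k : nat) : (k < M)%N ->
  f (dyadic 0 k) * f (dyadic 0 k.+1) < 0 ->
  forall m, exists i, [/\ (i < M * 2 ^ m)%N,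
    dyadic 0 k <= dyadic m i, dyadic m i.+1 <= dyadic 0 k.+1,
    forall x, dyadic 0 k <= x <= dyadic m i -> 0 < f (dyadic 0 k) * f x &
    forall x, dyadic m i.+1 <= x <= dyadic 0 k.+1 -> 0 < f (dyadic 0 k.+1) * f x].
Proof.
move=> kM kk; have fk2 j : (j <= M)%N -> 0 < f (dyadic 0 j) * f (dyadic 0 j).
  by move=> jM; rewrite -expr2 exprn_even_gt0//= f_dyadic// muln1.
elim=> [|m [i [iM ki ik fl fr]]].
  exists k; split=> //; first by rewrite muln1.
    by move=> x; rewrite -eq_le => /eqP <-; rewrite fk2// ltnW.
  by move=> x; rewrite -eq_le => /eqP <-; rewrite fk2.
have im' := doubleS_ltn iM; have im := ltnW im'.
have mm1 : dyadic m i <= dyadic m.+1 i.*2.+1 <= dyadic m i.+1.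
  by rewrite -!(dyadic_double m) !le_dyadic doubleS !leqnSn.
move: mm1 => /andP[mm1 mm2].
(* If the midpoint has the sign of the left end, the change lies in the right half; otherwise it
   lies in the left half. *)
have [fm|fm] := ltP 0 (f (dyadic 0 k) * f (dyadic m.+1 i.*2.+1)).
  exists i.*2.+1; rewrite -doubleS dyadic_double; split=> //.
    exact: le_trans mm1.
  move=> x /andP[kx xm]; have [xi|/ltW ix] := leP x (dyadic m i).
    by apply: fl; rewrite kx.
  have fi : 0 < f (dyadic 0 k) * f (dyadic m i) by apply: fl; rewrite ki lexx.
  rewrite mulrC in fi.
  apply: (@mul_gt0_trans (f (dyadic m i))) => //.
  rewrite -(dyadic_double m) same_sign_cell//.
    by rewrite dyadic_double; apply: mul_gt0_trans fm; rewrite mulrC.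
  by rewrite dyadic_double ix.
have fm' : 0 < f (dyadic 0 k.+1) * f (dyadic m.+1 i.*2.+1).
  have : f (dyadic 0 k) * f (dyadic m.+1 i.*2.+1) < 0.
    by rewrite lt_neqAle fm mulf_neq0 ?f_dyadic// muln1 ltnW.
  move=> fm2; have := fm2; rewrite -oppr_gt0 -mulrN => fm3.
  move: kk; rewrite -oppr_gt0 -mulrN => kk.
  by have := mul_gt0_trans kk fm3; rewrite mulrNN.
exists i.*2; rewrite dyadic_double; split=> //.
  exact: le_trans mm2 ik.
move=> x /andP[mx xk]; have [ix|/ltW xi] := leP (dyadic m i.+1) x.
  by apply: fr; rewrite ix.
have fi : 0 < f (dyadic 0 k.+1) * f (dyadic m i.+1) by apply: fr; rewrite ik lexx.
apply: (@mul_gt0_trans (f (dyadic m.+1 i.*2.+1))); first by rewrite mulrC.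
rewrite same_sign_cell//; last by rewrite -doubleS dyadic_double mx.
by rewrite -doubleS dyadic_double; exact: mul_gt0_trans fm' fi.
Qed.

(** One separating point is produced in every cell, crossing or not, so that knots can be indexed
    uniformly; the final disjunction records which case holds. *)
Lemma dyadic_single_crossing (k : nat) : (k < M)%N -> exists c,
  [/\ dyadic 0 k < c < dyadic 0 k.+1,
      forall x, dyadic 0 k <= x < c -> 0 < f (dyadic 0 k) * f x,
      forall x, c < x <= dyadic 0 k.+1 -> 0 < f (dyadic 0 k.+1) * f x &
      f c = 0 /\ f (dyadic 0 k) * f (dyadic 0 k.+1) < 0 \/
      0 < f (dyadic 0 k) * f c /\ 0 < f (dyadic 0 k.+1) * f c].
Proof.
move=> kM; have fk : f (dyadic 0 k) != 0 by rewrite f_dyadic// muln1 ltnW.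
have fk1 : f (dyadic 0 k.+1) != 0 by rewrite f_dyadic// muln1.
have lr : dyadic 0 k < dyadic 0 k.+1 by rewrite dyadicS ltrDl dyadic_width_gt0.
have [kk|kk|/esym/eqP] := ltgtP 0 (f (dyadic 0 k) * f (dyadic 0 k.+1)); last first.
- by rewrite mulf_eq0 (negbTE fk) (negbTE fk1).
- have [c cI fc] : exists2 c, c \in `[dyadic 0 k, dyadic 0 k.+1] & f c = 0.
    apply: IVT => //; first exact: ltW.
      exact: continuous_subspaceT.
    rewrite ge_min le_max; move: fk kk.
    have [l0 _|l0 _|->] := ltgtP (f (dyadic 0 k)) 0; last by [].
      by rewrite nmulr_rlt0// => /ltW ->; rewrite orbT.
    by rewrite pmulr_rlt0// => /ltW ->; rewrite orbT.
  exists c; move: cI; rewrite in_itv /= => /andP[kc ck].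
  (* The zero [c] cannot lie where [f] has a strict sign, so it is caught in the bisection cell of
     each level; these cells shrink to [c]. *)
  have cells m : exists i, [/\ dyadic m i < c < dyadic m i.+1,
      forall x, dyadic 0 k <= x <= dyadic m i -> 0 < f (dyadic 0 k) * f x &
      forall x, dyadic m i.+1 <= x <= dyadic 0 k.+1 -> 0 < f (dyadic 0 k.+1) * f x].
    have [i [_ ki ik fl fr]] := sign_change_cells kM kk m.
    exists i; split=> //; apply/andP; split; rewrite ltNge; apply/negP => ci.
      by have := fl c; rewrite kc ci fc mulr0 ltxx => /(_ isT).
    by have := fr c; rewrite ck ci fc mulr0 ltxx => /(_ isT).
  have cNk : c != dyadic 0 k by apply: contraNneq fk => <-; exact/eqP.
  have cNk1 : c != dyadic 0 k.+1 by apply: contraNneq fk1 => <-; exact/eqP.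
  split; last by left.
  + by rewrite !lt_neqAle kc ck eq_sym cNk cNk1.
  + move=> x /andP[kx xc]; have [|m wm] := @dyadic_width_small (c - x); first by rewrite subr_gt0.
    have [i [/andP[_ ci] fl _]] := cells m; apply: fl; rewrite kx /=.
    by move: ci; rewrite dyadicS; lra.
  + move=> x /andP[cx xk]; have [|m wm] := @dyadic_width_small (x - c); first by rewrite subr_gt0.
    have [i [/andP[ic _] _ fr]] := cells m; apply: fr; rewrite xk andbT.
    by rewrite dyadicS; lra.
(* With equal signs at the ends [f] keeps its sign on the whole cell, and any interior point would
   do. *)
- exists ((dyadic 0 k + dyadic 0 k.+1) / 2).
  have fx x : dyadic 0 k <= x <= dyadic 0 k.+1 -> 0 < f (dyadic 0 k) * f x.
    by apply: same_sign_cell => //; rewrite muln1.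
  have fx1 x : dyadic 0 k <= x <= dyadic 0 k.+1 -> 0 < f (dyadic 0 k.+1) * f x.
    by move=> /fx; apply: mul_gt0_trans.
  split.
  + by apply/andP; split; lra.
  + by move=> x /andP[kx xc]; apply: fx; apply/andP; split; lra.
  + by move=> x /andP[kx xc]; apply: fx1; apply/andP; split; lra.
  + by right; split; [apply: fx|apply: fx1]; apply/andP; split; lra.
Qed.

End DyadicCells.

(** * Nodal domains as unions of bands *)

Lemma consecutive_cover (R : realType) (x : nat -> R) n (y : R) : (0 < n)%N ->
  x 0%N <= y <= x n -> exists2 k, (k < n)%N & x k <= y <= x k.+1.
Proof.
case: n => // n _; elim: n => [xy|n IH /andP[x0 xn]]; first by exists 0%N.
have [yx|/ltW xy] := leP y (x n.+1); last by exists n.+1; rewrite ?xy.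
have [|k kn ky] := IH; first by rewrite x0.
by exists k => //; exact: ltnW.
Qed.

(* The knots p are x 0, x M and, in between, one point per cell
   where f may change sign, so that f has the sign of f (x k) on the whole of
   [p k, p k.+1]. *)
Lemma nodal_domain_bands (R : realType) (x : nat -> R) (M : nat) (f : R -> R) :
  (0 < M)%N -> (forall k, (k <= M)%N -> f (x k) != 0) ->
  (forall k, (k < M)%N -> exists c,
    [/\ x k < c < x k.+1,
        forall y, x k <= y < c -> 0 < f (x k) * f y,
        forall y, c < y <= x k.+1 -> 0 < f (x k.+1) * f y &
        f c = 0 /\ f (x k) * f (x k.+1) < 0 \/
        0 < f (x k) * f c /\ 0 < f (x k.+1) * f c]) ->
  exists p : nat -> R, (forall k, (k < M.+1)%N -> p k < p k.+1) /\
    forall s, nodal_domain (x 0%N) (x M) s f =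
              bands p M.+1 [set k | 0 <= s * f (x k)].
Proof.
move=> M0 fx cellP.
have /choice[c cP] : forall k, exists c, (k < M)%N ->
    [/\ x k < c < x k.+1,
        forall y, x k <= y < c -> 0 < f (x k) * f y,
        forall y, c < y <= x k.+1 -> 0 < f (x k.+1) * f y &
        f c = 0 /\ f (x k) * f (x k.+1) < 0 \/
        0 < f (x k) * f c /\ 0 < f (x k.+1) * f c].
  move=> k; case: (ltnP k M) => [/cellP[c cP]|_]; first by exists c.
  by exists 0.
have xle i j : (i <= j)%N -> (j <= M)%N -> x i <= x j.
  elim: j => [|j IH]; first by rewrite leqn0 => /eqP ->.
  rewrite leq_eqVlt => /orP[/eqP -> //|ij jM].
  apply: le_trans (IH ij (ltnW jM)) _.
  by have [/andP[xc cx] _ _ _] := cP _ jM; exact: ltW (lt_trans xc cx).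
(* The shift by one makes [x k] lie between [p k] and [p k.+1]. The [M.+2] knots bound [M.+1] bands,
   one per grid point. *)
pose p k := if k is j.+1 then if (j < M)%N then c j else x M else x 0%N.
have pS k : (k < M)%N -> p k.+1 = c k by move=> /= ->.
have pM : p M.+1 = x M by rewrite /= ltnn.
have px k : (k <= M)%N -> p k <= x k.
  case: k => [//|k kM]; rewrite pS//.
  by have [/andP[_ /ltW]] := cP _ kM.
have xp k : (k <= M)%N -> x k <= p k.+1.
  rewrite leq_eqVlt => /orP[/eqP ->|kM]; first by rewrite pM.
  by rewrite pS//; have [/andP[/ltW]] := cP _ kM.
have sgn (s u v : R) : 0 < u * v -> 0 <= s * u -> 0 <= s * v.
  move=> uv su; have u0 : u != 0 by apply: contraTneq uv => ->; rewrite mul0r ltxx.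
  have u2 : 0 < u ^+ 2 by rewrite exprn_even_gt0.
  rewrite -(pmulr_rge0 _ u2) (_ : u ^+ 2 * (s * v) = (s * u) * (u * v)); last by ring.
  by rewrite mulr_ge0// ltW.
exists p; split=> [k|s].
  rewrite ltnS => kM; have [kM'|Mk] := ltnP k M.
    rewrite pS//; have [/andP[xc _] _ _ _] := cP _ kM'.
    exact: le_lt_trans (px _ kM) xc.
  (* The last band is nondegenerate because [p M] is the separating point of the last cell, which
     exists as [0 < M]. *)
  have -> : k = M by apply/eqP; rewrite eqn_leq kM.
  rewrite pM; case: M M0 cP {fx cellP xle pS pM px xp} @p kM Mk => // m _ cP p _ _.
  by rewrite /p leqnn; have [/andP[]] := cP _ (ltnSn m).
apply/seteqP; split=> y /=.
  move=> [ay fy]; have [k kM /andP[ky yk]] := consecutive_cover M0 ay.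
  have [/andP[xc cx] fl fr fc] := cP _ kM.
  have [yc|cy|yc] := ltgtP y (c k).
  - exists k; split; first exact: ltnW.
      by apply: sgn fy; rewrite mulrC fl// ky.
    by rewrite pS// (ltW yc) (le_trans (px _ (ltnW kM))).
  - exists k.+1; split=> //.
      by apply: sgn fy; rewrite mulrC fr// cy.
    by rewrite pS// (ltW cy) (le_trans yk)// xp.
  (* The knot [c k] belongs to both adjacent bands. If [x k] has the wrong sign, then [f] vanishes
     at [c k] and changes sign there, so [x k.+1] has the right one. *)
  - have [sk|sk] := leP 0 (s * f (x k)).
      exists k; split=> //; first exact: ltnW.
      by rewrite pS// yc lexx andbT (le_trans (px _ (ltnW kM)))// ltW.
    exists k.+1; split=> //; last first.
      by rewrite pS// yc lexx (le_trans (ltW cx))// xp.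
    case: fc => [[_ kk]|[fc _]]; last first.
      by move: sk; rewrite ltNge (sgn _ _ _ _ fy)// mulrC yc.
    have fk2 : 0 < f (x k) ^+ 2 by rewrite exprn_even_gt0//= fx// ltnW.
    rewrite /= -(pmulr_rge0 _ fk2).
    rewrite (_ : f (x k) ^+ 2 * (s * f (x k.+1)) = (s * f (x k)) * (f (x k) * f (x k.+1))); last by ring.
    by rewrite nmulr_rge0// ltW.
move=> [k [kM fk /andP[py yp]]]; rewrite ltnS in kM.
(* The part of band [k] before [x k] lies in the preceding grid cell, past its separating point; the
   part after [x k] lies in cell [k], up to [c k]. *)
have [yx|/ltW xy] := leP y (x k).
  case: k kM fk py yp yx => [|k] kM fk py yp yx.
    have -> : y = x 0%N by apply/eqP; rewrite eq_le py yx.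
    by split=> //; rewrite lexx xle.
  rewrite pS// in py; have [/andP[xc cx] fl fr fc] := cP _ kM.
  split; first by rewrite (le_trans _ py) ?(le_trans yx) ?xle// (le_trans _ (ltW xc))// xle// ltnW.
  move: py; rewrite le_eqVlt => /orP[/eqP <-|cy].
    case: fc => [[-> _]|[_ fc]]; first by rewrite mulr0.
    exact: sgn fc fk.
  by apply: sgn fk; apply: fr; rewrite cy.
move: kM; rewrite leq_eqVlt => /orP[/eqP kM|kM].
  rewrite kM pM in yp; have -> : y = x k by apply/eqP; rewrite eq_le xy kM yp.
  by split=> //; rewrite kM xle ?lexx.
rewrite pS// in yp; have [/andP[xc cx] fl fr fc] := cP _ kM.
split; first by rewrite (le_trans _ xy) ?xle ?(le_trans yp) ?(le_trans (ltW cx)) ?xle// ltnW.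
move: yp; rewrite le_eqVlt => /orP[/eqP ->|yc].
  case: fc => [[-> _]|[fc _]]; first by rewrite mulr0.
  exact: sgn fc fk.
by apply: sgn fk; apply: fl; rewrite xy.
Qed.

(** * Critical zeros and the deterministic comparison of homology *)

(** Fermat's rule: [c] is an interior minimum or maximum of [g] according to the sign of [s], so the
    derivative vanishes there. *)
Lemma zero_critical_value_local_extremum (R : realType) (a b : R) (f g : R -> R)
    (s p q c : R) :
  (forall x, a <= x <= b -> g x = f x) -> (forall x, derivable g x 1) ->
  a <= p -> q <= b -> p < c < q -> s != 0 ->
  (forall x, p <= x <= q -> 0 <= s * g x) -> g c = 0 ->
  zero_critical_value a b f.
Proof.
move=> gf dg ap qb /andP[pc cq] s0 sg gc.
have cab : a <= c <= b by apply/andP; split; lra.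
have pq : p <= q by lra.
have cpq : c \in `]p, q[ by rewrite in_itv /= pc cq.
have sg' x : x \in `]p, q[ -> 0 <= s * g x.
  by rewrite in_itv /= => /andP[/ltW px /ltW xq]; apply: sg; rewrite px.
have dgc : is_derive c 1 g 0.
  have [s_gt0|s_lt0|s_eq0] := ltgtP 0 s; last by rewrite -s_eq0 eqxx in s0.
    apply: derive1_at_min pq (fun x _ => dg x) cpq _ => x /sg'.
    by rewrite gc pmulr_rge0.
  apply: derive1_at_max pq (fun x _ => dg x) cpq _ => x /sg'.
  by rewrite gc nmulr_rge0.
exists c; split; [exact: cab | by rewrite -gf |].
(* The derivative is rewritten as a limit of difference quotients in [y = h + c], then restricted to
   [a, b], where [g] agrees with [f]. *)
have : h^-1 *: (g (h + c) - g c) @[h --> 0^'] --> (0 : R).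
  have [dc dc0] := dgc; have := dc; rewrite /derivable => /cvg_ex[l gl].
  have : l = 0 by rewrite -dc0; apply/esym/cvg_lim.
  move=> l0; rewrite l0 in gl; apply: cvg_trans gl; apply: near_eq_cvg.
  by near=> h; rewrite /= [h *: 1]mulr1.
move=> /cvgrPdist_lt gl; apply/cvgrPdist_lt => e e0.
have /nbhs_ballP[r /= r0 re] := gl e e0.
apply/nbhs_ballP; exists r => //= y cy [yab yc].
have := re (y - c); rewrite /ball /= sub0r normrN distrC subr_eq0 => /(_ cy yc).
rewrite subrK !gf// sub0r normrN sub0r normrN.
by rewrite /GRing.scale /= mulrC.
Unshelve. all: by end_near. Qed.

Lemma cubical_approx_bands (R : realType) (a b s : R) (M : nat) (f : R -> R) :
  cubical_approx a b s M f =
  bands (fun k => k%:R) M.+1 [set k | 0 <= s * f (dyadic a ((b - a) / M%:R) 0 k)].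
Proof.
have gridE k : grid_point a b M k = dyadic a ((b - a) / M%:R) 0 k.
  by rewrite /grid_point /dyadic expr0 divr1 mulrA.
by apply/seteqP; split=> y /= [k [kM fk ky]]; exists k;
  move: fk ky; rewrite gridE natr1.
Qed.

Lemma dyadic_right_end (R : realType) (a b : R) (M : nat) : (0 < M)%N ->
  dyadic a ((b - a) / M%:R) 0 M = b.
Proof.
move=> M0; rewrite /dyadic expr0; field.
by rewrite pnatr_eq0 -lt0n.
Qed.

(** The bisection runs on the extension [g] to the whole line. Since [g] and [f] agree on [a, b],
    signs at dyadic points and nodal domains are the same for both. *)
Lemma homology_iso_nodal_cubical (R : realType) (a b : R) (M : nat) (f : R -> R) :
  a < b -> (0 < M)%N -> C2_on a b f -> ~ zero_critical_value a b f ->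
  (forall n j, (j <= M * 2 ^ n)%N -> f (dyadic a ((b - a) / M%:R) n j) != 0) ->
  (forall n j, (j < M * 2 ^ n)%N ->
    0 < f (dyadic a ((b - a) / M%:R) n j) * f (dyadic a ((b - a) / M%:R) n j.+1) ->
    0 < f (dyadic a ((b - a) / M%:R) n j) *
        f (dyadic a ((b - a) / M%:R) n.+1 j.*2.+1)) ->
  forall s, homology_iso_all (nodal_domain a b s f) (cubical_approx a b s M f).
Proof.
move=> ab M0 [g [gf dg _ _]] nocrit; set w := (b - a) / M%:R => f0 f1.
have w0 : 0 < w by rewrite divr_gt0 ?subr_gt0 ?ltr0n.
have wb : dyadic a w 0 M = b by exact: dyadic_right_end.
have gfd n j : (j <= M * 2 ^ n)%N -> g (dyadic a w n j) = f (dyadic a w n j).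
  by move=> jM; rewrite gf// dyadic_ge//= -wb dyadic_last.
have [||p [plt pE]] := @nodal_domain_bands R (dyadic a w 0) M g M0 _ _.
- by move=> k kM; rewrite gfd ?f0 ?muln1.
- apply: dyadic_single_crossing => //.
  + by move=> x; apply/differentiable_continuous/derivable1_diffP.
  + by move=> n j jM; rewrite gfd ?f0.
  + move=> n j jM; rewrite !gfd//; first exact: f1.
    * by apply: ltnW; exact: doubleS_ltn.
    * exact: ltnW.
  + move=> s p q c ap; rewrite wb => qb pcq s0 sg; apply/eqP => gc.
    exact/nocrit/(@zero_critical_value_local_extremum _ _ _ _ _ s p q c gf).
move=> s; have [h [h' [hK h'K hc h'c hh']]] := bands_homeo plt.
have -> : nodal_domain a b s f = bands p M.+1 [set k | 0 <= s * f (dyadic a w 0 k)].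
  rewrite -[a in nodal_domain a](_ : dyadic a w 0 0 = a); last by rewrite /dyadic mul0r addr0.
  rewrite -wb (_ : nodal_domain _ _ s f = nodal_domain (dyadic a w 0 0) (dyadic a w 0 M) s g).
    by rewrite pE; apply: eq_bands => k kM /=; rewrite gfd// muln1.
  apply/seteqP; split=> y /= [ay fy]; split=> //; move: ay fy;
    by rewrite wb /dyadic mul0r addr0 => /gf ->.
rewrite cubical_approx_bands.
have [hA h'A] := hh' [set k | 0 <= s * f (dyadic a w 0 k)].
exact: homology_iso_all_homeo hK h'K hc h'c hA h'A.
Qed.

(** * Probability of double crossings *)

Section CrossingProbability.
Variables (R : realType) (d : measure_display) (Omega : measurableType d).
Variable P : probability Omega R.

Lemma measurable_preimage_ge0 (v : Omega -> R) (s : R) :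
  measurable_fun setT v -> measurable [set w | 0 <= s * v w].
Proof.
move=> mv; have mf : measurable_fun setT (fun w => s * v w).
  by apply: measurable_funM => //; exact: measurable_cst.
have := mf measurableT _ (measurable_itv `[0, +oo[).
by rewrite setTI; congr measurable; apply/seteqP; split=> w /=;
  rewrite in_itv /= andbT.
Qed.

Definition double_crossing (u : R -> Omega -> R) (s x delta : R) : set Omega :=
  [set w | [/\ 0 <= s * u x w, s * u (x + delta / 2) w <= 0
             & 0 <= s * u (x + delta) w]].

Lemma measurable_double_crossing (u : R -> Omega -> R) (a b s x delta : R) :
  (forall x, a <= x <= b -> measurable_fun setT (u x)) ->
  a <= x -> 0 < delta -> x + delta <= b ->
  measurable (double_crossing u s x delta).
Proof.
move=> mu ax d0 xb.
rewrite (_ : double_crossing _ _ _ _ = [set w | 0 <= s * u x w] `&`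
  [set w | 0 <= - s * u (x + delta / 2) w] `&` [set w | 0 <= s * u (x + delta) w]).
  by apply: measurableI; [apply: measurableI|];
    apply: measurable_preimage_ge0; apply: mu; apply/andP; split; lra.
by apply/seteqP; split=> w /=; rewrite mulNr oppr_ge0; [case|case=> -[]].
Qed.

Definition cell_double_crossing (u : R -> Omega -> R) (a w : R) (n j : nat) : set Omega :=
  double_crossing u 1 (dyadic a w n j) (w / 2 ^+ n) `|`
  double_crossing u (-1) (dyadic a w n j) (w / 2 ^+ n).

Definition level_double_crossing (u : R -> Omega -> R) (a w : R) (M n : nat) : set Omega :=
  \big[setU/set0]_(j < M * 2 ^ n) cell_double_crossing u a w n j.

Variables (a b C0 : R) (u : R -> Omega -> R) (M : nat).
Hypothesis ab : a < b.
Hypothesis M0 : (0 < M)%N.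
Hypothesis mu : forall x, a <= x <= b -> measurable_fun setT (u x).
Hypothesis C0_gt0 : 0 < C0.
Hypothesis uP : forall (s x delta : R), (s = 1 \/ s = -1) ->
  a <= x -> 0 < delta -> x + delta <= b ->
  (P (double_crossing u s x delta) <= (C0 * delta ^+ 3)%:E)%E.

Let W := (b - a) / M%:R.

Let W0 : 0 < W.
Proof. by rewrite divr_gt0 ?subr_gt0 ?ltr0n. Qed.

Let dyadic_b n j : (j <= M * 2 ^ n)%N -> dyadic a W n j <= b.
Proof.
by move=> jM; rewrite -[b in leRHS](dyadic_right_end a b M0); exact: dyadic_last.
Qed.

Let mcross n j s : (j < M * 2 ^ n)%N ->
  measurable (double_crossing u s (dyadic a W n j) (W / 2 ^+ n)).
Proof.
move=> jM; apply: measurable_double_crossing mu _ _ _.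
- exact: dyadic_ge.
- exact: dyadic_width_gt0.
- by rewrite -dyadicS dyadic_b.
Qed.

Lemma measurable_level_double_crossing n : measurable (level_double_crossing u a W M n).
Proof. by apply: bigsetU_measurable => j _; apply: measurableU; exact: mcross. Qed.

(** Union bound over [M * 2 ^ n] cells and two signs: the cubic bound on each cell beats the number
    of cells, leaving the ratio 1/4 per level. *)
Lemma prob_level_double_crossing n :
  (P (level_double_crossing u a W M n) <=
   (2 * C0 * (b - a) ^+ 3 / M%:R ^+ 2 * 4^-1 ^+ n)%:E)%E.
Proof.
have Pc (s : R) j : (s = 1 \/ s = -1) -> (j < M * 2 ^ n)%N ->
    (P (double_crossing u s (dyadic a W n j) (W / 2 ^+ n)) <=
      (C0 * (W / 2 ^+ n) ^+ 3)%:E)%E.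
  move=> s1 jM; apply: uP => //.
  - exact: dyadic_ge.
  - exact: dyadic_width_gt0.
  - by rewrite -dyadicS dyadic_b.
apply: (@le_trans _ _ (\sum_(j < M * 2 ^ n) (2 * (C0 * (W / 2 ^+ n) ^+ 3))%:E)%E).
  have mF j : (j < M * 2 ^ n)%N -> measurable (cell_double_crossing u a W n j).
    by move=> jM; apply: measurableU; exact: mcross.
  apply: (le_trans (Boole_inequality P mF)).
  apply: lee_sum => j _.
  apply: le_trans (measureU2 _ _ _) _; try exact: mcross.
  rewrite mulrDl mul1r EFinD; apply: leeD; apply: Pc => //; [by left|by right].
rewrite sumEFin lee_fin sumr_const card_ord -[leLHS]mulr_natl natrM natrX.
rewrite le_eqVlt; apply/orP; left; apply/eqP; rewrite /W.
have -> : 4^-1 ^+ n = (2 ^+ n)^-1 ^+ 2 :> R.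
  by rewrite -!exprVn -exprM mulnC exprM; congr (_ ^+ n); field.
by field; rewrite expf_neq0 ?pnatr_eq0// -?lt0n// M0.
Qed.

(** The geometric series of ratio 1/4 contributes the factor 4/3, which turns the constant 2 of
    level 0 into 8/3. *)
Lemma prob_double_crossings :
  (P (\bigcup_n level_double_crossing u a W M n) <=
   (8 * C0 * (b - a) ^+ 3 / (3 * M%:R ^+ 2))%:E)%E.
Proof.
have mL := measurable_level_double_crossing.
apply: le_trans (generalized_Boole_inequality P mL (bigcup_measurable (fun n _ => mL n))) _.
set K := 2 * C0 * (b - a) ^+ 3 / M%:R ^+ 2.
have K0 : 0 <= K.
  by rewrite divr_ge0 ?exprn_ge0// mulr_ge0 ?exprn_ge0 ?subr_ge0 ?ltW// mulr_gt0.
apply: lime_le; first by apply: is_cvg_nneseries => n _ _; exact: measure_ge0.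
near=> m; apply: (@le_trans _ _ (\sum_(0 <= n < m) (K * 4^-1 ^+ n)%:E)%E).
  by apply: lee_sum => n _; exact: prob_level_double_crossing.
rewrite sumEFin lee_fin.
have -> : \sum_(0 <= n < m) K * 4^-1 ^+ n = series (geometric K 4^-1) m by [].
rewrite geometric_seriesE; last by lra.
rewrite /=; have -> : 8 * C0 * (b - a) ^+ 3 / (3 * M%:R ^+ 2) = K * 1 / (1 - 4^-1).
  rewrite /K; field; rewrite pnatr_eq0 -lt0n M0 /=.
  lra.
rewrite ler_pM2r ?invr_gt0; last by lra.
by rewrite ler_wpM2l// gerBl exprn_ge0.
Unshelve. all: by end_near. Qed.

(** If the midpoint failed to share the common sign of the ends, the sign of the left value would
    select the [double_crossing] event containing [w]. *)
Lemma single_crossing_outside w n j :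
  ~ (\bigcup_n level_double_crossing u a W M n) w -> (j < M * 2 ^ n)%N ->
  0 < u (dyadic a W n j) w * u (dyadic a W n j.+1) w ->
  0 < u (dyadic a W n j) w * u (dyadic a W n.+1 j.*2.+1) w.
Proof.
move=> nw jM jj; rewrite ltNge; apply/negP => jm; apply: nw; exists n => //.
rewrite /level_double_crossing -(bigcup_mkord _ (cell_double_crossing u a W n)); exists j => //.
have midE : dyadic a W n.+1 j.*2.+1 = dyadic a W n j + W / 2 ^+ n / 2.
  by rewrite dyadicS dyadic_double exprS invfM mulrA [_ / 2 / _]mulrAC.
move: jj jm; rewrite midE dyadicS => jj jm.
have [j0|j0|j0] := ltgtP 0 (u (dyadic a W n j) w); last by rewrite -j0 mul0r ltxx in jj.
  left; split; rewrite mul1r ?(ltW j0)//; first by rewrite -(pmulr_rle0 _ j0).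
  by rewrite -(pmulr_rge0 _ j0) ltW.
right; split; rewrite mulN1r ?oppr_ge0 ?oppr_le0 ?(ltW j0)//.
  by rewrite -(nmulr_rle0 _ j0).
by rewrite -(nmulr_rge0 _ j0) ltW.
Qed.

(** (A1) at each of countably many points; indices beyond the last cell contribute the empty set. *)
Lemma negligible_dyadic_zero :
  (forall x, a <= x <= b -> P [set w | u x w = 0] = 0%E) ->
  P.-negligible (\bigcup_n \bigcup_j
    [set w | (j <= M * 2 ^ n)%N /\ u (dyadic a W n j) w = 0]).
Proof.
move=> u0; apply: negligible_bigcup => n; apply: negligible_bigcup => j.
have [jM|jM] := leqP j (M * 2 ^ n)%N; last first.
  by apply: (negligibleS _ (negligible_set0 P)) => w [].
have xab : a <= dyadic a W n j <= b by rewrite dyadic_ge//= dyadic_b.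
exists [set w | u (dyadic a W n j) w = 0]; split; [|exact: u0|by move=> w []].
have := mu xab measurableT (measurable_set1 (0 : R)).
by rewrite setTI.
Qed.

End CrossingProbability.

(** * Probability of recovering the homology of the nodal domains *)

Theorem theorem1p4 (R : realType) (d : measure_display) (Omega : measurableType d)
  (P : probability Omega R) (a b : R) (u : R -> Omega -> R) (C0 : R) :
  a < b ->
  (* u is a random field on G = [a,b] *)
  (forall x, a <= x <= b -> measurable_fun setT (u x)) ->
  (* (A1) *)
  (forall x, a <= x <= b -> P [set w | u x w = 0] = 0%E) ->
  (* (A2) *)
  {ae P, forall w, ~ zero_critical_value a b (fun x => u x w)} ->
  (* almost surely C^2 *)
  {ae P, forall w, C2_on a b (fun x => u x w)} ->
  0 < C0 ->
  (forall (s x delta : R), (s = 1 \/ s = -1) ->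
     a <= x -> 0 < delta -> x + delta <= b ->
     (P [set w | [/\ (0 <= s * u x w)%R, (s * u (x + delta / 2) w <= 0)%R
                   & (0 <= s * u (x + delta) w)%R]] <= (C0 * delta ^+ 3)%:E)%E) ->
  forall M : nat, (0 < M)%N ->
  exists E : set Omega,
    [/\ measurable E,
        E `<=` [set w |
            homology_iso_all (nodal_domain a b 1 (fun x => u x w))
                             (cubical_approx a b 1 M (fun x => u x w))
         /\ homology_iso_all (nodal_domain a b (-1) (fun x => u x w))
                             (cubical_approx a b (-1) M (fun x => u x w))]
      & ((1 - 8 * C0 * (b - a) ^+ 3 / (3 * M%:R ^+ 2))%R%:E <= P E)%E].
Proof.
move=> ab mu u0 nocrit uC2 C00 uP M M0; pose W := (b - a) / M%:R.
(* [N] is a measurable null set covering the failures of (A2) and of smoothness, and the zeros at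
   dyadic points. *)
have [N [mN PN NP]] := negligibleU (negligibleU nocrit uC2)
  (negligible_dyadic_zero (P := P) ab M0 mu u0).
pose B := \bigcup_n level_double_crossing u a W M n.
have mB : measurable B.
  by apply: bigcup_measurable => n _; exact: measurable_level_double_crossing.
(* Measurability of the homology event itself is not established, so its probability is bounded from
   below through this measurable subset. *)
exists (~` (N `|` B)); split.
- by apply: measurableC; exact: measurableU.
- move=> w /not_orP[wN wB].
  have hom : forall s, homology_iso_all (nodal_domain a b s (fun x => u x w))
                                        (cubical_approx a b s M (fun x => u x w)).
    apply: homology_iso_nodal_cubical => //.
    + by apply: contrapT => nC; apply: wN; apply: NP; left; right.
    + by move=> cr; apply: wN; apply: NP; left; left => /(_ cr).
    + move=> n j jM; apply/eqP => uz; apply: wN; apply: NP; right.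
      by exists n => //; exists j.
    + by move=> n j; apply: single_crossing_outside wB.
  by split.
- rewrite probability_setC; last exact: measurableU.
  rewrite EFinB leeB// (le_trans (measureU2 _ _ _))// PN add0e.
  exact: prob_double_crossings.
Qed.
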